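(* Let $\{\mathbb{B}_s:0<s\le s_0\}$ be a scale of Banach spaces and consider the family of initial value problems $$\frac{du_\varepsilon(t)}{dt}=A_\varepsilon u_\varepsilon(t),\qquad u_\varepsilon(0)=u_\varepsilon\in\mathbb{B}_{s_0},\qquad \varepsilon\ge0, \qquad( * )$$ where, for each fixed $s\in(0,s_0)$ and for each pair $s',s''$ such that $s\le s'<s''\le s_0$, $A_\varepsilon:\mathbb{B}_{s''}\to\mathbb{B}_{s'}$ is a linear mapping so that there is an $M>0$ such that for all $u\in\mathbb{B}_{s''}$ $$\|A_\varepsilon u\|_{s'}\le\frac{M}{s''-s'}\|u\|_{s''}.$$ Here $M$ is independent of $\varepsilon,s',s''$ and $u$, but it may depend continuously on $s,s_0$. Assume that there is a $p\in\mathbb{N}$ and for each $\varepsilon>0$ there is an $N_\varepsilon>0$ such that for each pair $s',s''$, $s\le s'<s''\le s_0$, and all $u\in\mathbb{B}_{s''}$ $$\|A_\varepsilon u-A_0u\|_{s'}\le\sum_{k=1}^p\frac{N_\varepsilon}{(s''-s')^k}\|u\|_{s''}.$$ In addition, assume that $\lim_{\varepsilon\to0}N_\varepsilon=0$ and $\lim_{\varepsilon\to0}\|u_\varepsilon(0)-u_0(0)\|_{s_0}=0$. Then, for each $s\in(0,s_0)$, there is a constant $\delta>0$ (which depends on $M$) such that there is a unique solution $u_\varepsilon:[0,\delta(s_0-s))\to\mathbb{B}_s$, $\varepsilon\ge0$, to each initial value problem $( * )$, and for all $t\in[0,\delta(s_0-s))$ $$\lim_{\varepsilon\to0}\|u_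\varepsilon(t)-u_0(t)\|_s=0.$$
   Context: A scale of Banach spaces is a one-parameter family of Banach spaces $\{\mathbb{B}_s:0<s\le s_0\}$ such that for any $0<s'<s''\le s_0$ one has $\mathbb{B}_{s''}\subseteq\mathbb{B}_{s'}$ and $\|\cdot\|_{s'}\le\|\cdot\|_{s''}$, where $\|\cdot\|_s$ is the norm of $\mathbb{B}_s$. For each $\varepsilon$, the mappings $A_\varepsilon:\mathbb{B}_{s''}\to\mathbb{B}_{s'}$ for different pairs are the same operator $A_\varepsilon$ considered between different spaces of the scale. A solution with values in $\mathbb{B}_s$ on $[0,T)$ is a function $u:[0,T)\to\mathbb{B}_s$, continuous on $[0,T)$ and continuously differentiable on $(0,T)$ in $\mathbb{B}_s$, with $A_\varepsilon u(t)\in\mathbb{B}_s$, satisfying the equation and the initial condition. *)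

(* Defs.v *)
From HB Require Import structures.
From mathcomp Require Import all_boot all_order all_algebra.
From mathcomp Require Import all_classical all_reals all_analysis.

Set Implicit Arguments.
Unset Strict Implicit.
Unset Printing Implicit Defensive.

Import Order.TTheory GRing.Theory Num.Theory.
Import numFieldNormedType.Exports.

Local Open Scope classical_set_scope.
Local Open Scope ring_scope.

(** The spaces are realized as subspaces of one vector space [ambient] (such as
    the union of the scale): the subspace of index [s] is the range of the
    injective linear map [emb s]. Only the indices [0 < s <= s0] matter. *)
Record banach_scale (R : realType) (s0 : R) := BanachScale {
  ambient : lmodType R;
  space :> R -> completeNormedModType R;
  emb : forall s : R, {linear space s -> ambient};
  emb_inj : forall s : R, 0 < s -> s <= s0 -> injective (emb s);
  emb_sub : forall s' s'' : R, 0 < s' -> s' < s'' -> s'' <= s0 ->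
    forall x : space s'',
      exists2 y : space s', emb s' y = emb s'' x & `|y| <= `|x|
}.

Section ScaleDefs.
Variables (R : realType) (s0 : R) (B : banach_scale s0).

(** [T] maps the space of index [s''] linearly into the space of index [s'].
    The values of [T] outside of the scale are irrelevant. *)
Definition linear_on_scale (T : ambient B -> ambient B) (s'' s' : R) : Prop :=
  (forall x : B s'', exists y : B s', emb B s' y = T (emb B s'' x)) /\
  (forall (a : R) (x y : B s''),
     T (emb B s'' (a *: x + y)) = a *: T (emb B s'' x) + T (emb B s'' y)).

(** The norm of [T x] is the one of the space of index [s']: [emb B s'] is
    injective, so that [y] is the element [T x] of that space. *)
Definition bounded_on_scale (T : ambient B -> ambient B) (s'' s' C : R) : Prop :=
  forall x : B s'',
    exists2 y : B s', emb B s' y = T (emb B s'' x) & `|y| <= C * `|x|.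

(** Only the values of [u] on [0, T[ matter. *)
Definition is_solution (A : ambient B -> ambient B) (u0 : B s0) (s T : R)
    (u : R -> B s) : Prop :=
  [/\ {within `[0, T[, continuous u},
      (forall t : R, t \in `]0, T[ -> derivable u t 1) /\
        {in `]0, T[, continuous (derive1 u)},
      forall t : R, t \in `[0, T[ ->
        exists v : B s, emb B s v = A (emb B s (u t)),
      forall t : R, t \in `]0, T[ ->
        emb B s (derive1 u t) = A (emb B s (u t)) &
      emb B s (u 0) = emb B s0 u0].

End ScaleDefs.

(* Main.v *)
Require Import Defs.
From HB Require Import structures.
From mathcomp Require Import all_boot all_order all_algebra.
From mathcomp Require Import all_classical all_reals all_analysis.
From mathcomp Require Import ring lra.

Set Implicit Arguments.
Unset Strict Implicit.
Unset Printing Implicit Defensive.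

Import Order.TTheory GRing.Theory Num.Theory.
Import numFieldNormedType.Exports.

Local Open Scope classical_set_scope.
Local Open Scope ring_scope.

(** The solution is the power series [sum_n t^n/n! A^n u0]. Passing from index
    [s0] to [s] in [n] equal steps costs [(M n / (s0 - s))^n] for [A^n u0], and
    [n^n <= exp(n) n!], so the series converges in the space of index [s] as soon
    as [exp(1) M t < s0 - s]; hence [delta m = 1 / (exp(1) m)]. The same count of steps,
    combined with [n] successive integrations in time, shows that the
    difference of two solutions with values in the space of index [s] vanishes,
    when it is measured in a larger space of index [s / 2], on short time
    intervals of a fixed length. In the limit of vanishing perturbation, each
    term of the series converges because a fixed number of applications of the operator can afford
    any loss of index, and the series are dominated by one geometric series. *)

(** * Estimates on powers and factorials *)

(** [n^n / n!] is a single term of the exponential series at [n], whose terms are nonnegative and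
    whose sum is [exp(n)]. *)
Lemma exprn_le_fact_expR (R : realType) (n : nat) :
  (n%:R : R) ^+ n <= expR 1 ^+ n * n`!%:R.
Proof.
rewrite -ler_pdivrMr ?ltr0n ?fact_gt0// -expRM_natl mulr1.
have := @nondecreasing_cvgn_le _ (series (exp_coeff (n%:R : R))) _
  (is_cvg_series_exp_coeff n%:R) n.+1.
rewrite /series /= big_nat_recr//= => h; apply: le_trans (h _).
  rewrite lerDr sumr_ge0// => i _; exact: exp_coeff_ge0.
by apply: nondecreasing_series => i _ _; exact: exp_coeff_ge0.
Qed.

(** Each of the [n] powers [z^i] with [i < n] is at least [z^n], and their sum stays below the
    geometric series. This absorbs polynomial factors into a slightly slower geometric decay. *)
Lemma mulrn_exprn_le (R : realType) (z : R) (n : nat) :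
  0 <= z -> z < 1 -> n%:R * z ^+ n <= (1 - z)^-1.
Proof.
move=> z0 z1; have z1' : 0 < 1 - z by rewrite subr_gt0.
apply: (@le_trans _ _ (\sum_(i < n) z ^+ i)).
  rewrite mulr_natl -[n in _ *+ n]card_ord -sumr_const; apply: ler_sum => i _.
  by apply: ler_wiXn2l; rewrite ?(ltW z1)// ltnW.
rewrite -[leRHS]mulr1 ler_pdivlMl//.
have -> : (1 - z) * \sum_(i < n) z ^+ i = 1 - z ^+ n.
  by rewrite -[in RHS](expr1n _ n) subrXX; under [in RHS]eq_bigr do rewrite expr1n mul1r.
by rewrite gerBl exprn_ge0.
Qed.

(** Induction on [n], splitting one factor [t + h] off the power. The factor [r^2] on the left
    replaces a division on the right: it avoids the exponent [n - 2] and covers [r = 0]. *)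
Lemma exprn_taylor1 (R : realType) (t h r : R) (n : nat) :
  0 <= r -> `|t| <= r -> `|t + h| <= r ->
  `|(t + h) ^+ n - t ^+ n - h * (n%:R * t ^+ n.-1)| * r ^+ 2 <=
  h ^+ 2 * (n%:R ^+ 2 * r ^+ n).
Proof.
move=> r0 tr thr; elim: n => [|n IH].
  by rewrite !expr0 subrr mul0r mulr0 subr0 normr0 mul0r expr0n /= mul0r mulr0.
have -> : (t + h) ^+ n.+1 - t ^+ n.+1 - h * (n.+1%:R * t ^+ n.+1.-1) =
    (t + h) * ((t + h) ^+ n - t ^+ n - h * (n%:R * t ^+ n.-1)) +
    n%:R * h ^+ 2 * t ^+ n.-1.
  case: n {IH} => [|n] /=; first by ring.
  by rewrite -[n.+2%:R]natr1 !exprS; ring.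
have {}IH := ler_wpM2l r0 IH.
have tn : n%:R * h ^+ 2 * `|t| ^+ n.-1 * r ^+ 2 <= n%:R * h ^+ 2 * r ^+ n.+1.
  case: n {IH} => [|n] /=; first by rewrite !mul0r.
  have -> : r ^+ n.+2 = r ^+ n * r ^+ 2 by rewrite -exprD addn2.
  rewrite -mulrA (ler_wpM2l (mulr_ge0 (ler0n _ _) (sqr_ge0 h)))//.
  by rewrite ler_wpM2r ?sqr_ge0// lerXn2r ?nnegrE.
apply: le_trans (_ : (`|t + h| * `|(t + h) ^+ n - t ^+ n - h * (n%:R * t ^+ n.-1)|
   + n%:R * h ^+ 2 * `|t| ^+ n.-1) * r ^+ 2 <= _).
  rewrite ler_wpM2r ?sqr_ge0//; apply: le_trans (ler_normD _ _) _.
  by rewrite !(normrM _ (_ - _)) (normrM _ (t ^+ _)) normrX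
    (ger0_norm (mulr_ge0 (ler0n _ _) (sqr_ge0 h))).
rewrite mulrDl; apply: le_trans (lerD (le_trans _ IH) tn) _.
  by rewrite -mulrA; apply: ler_wpM2r => //; rewrite mulr_ge0 ?sqr_ge0.
rewrite -natr1 (exprS r n).
have : 0 <= h ^+ 2 * (n%:R + 1) * (r * r ^+ n).
  apply: mulr_ge0; last by rewrite mulr_ge0 ?exprn_ge0.
  by apply: mulr_ge0; rewrite ?sqr_ge0 ?addr_ge0.
lra.
Qed.

(** * Derivatives and the mean value inequality in normed spaces *)

Lemma is_derive1P (R : realType) (V : normedModType R) (f : R -> V) (t : R) (l : V) :
  is_derive t 1 f l <->
  forall e : R, 0 < e -> exists2 d : R, 0 < d &
    forall h, `|h| < d -> `|f (t + h) - f t - h *: l| <= e * `|h|.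
Proof.
have E h : h != 0 -> h^-1 *: ((f \o shift t) (h *: 1) - f t) - l =
    h^-1 *: (f (t + h) - f t - h *: l).
  move=> h0; rewrite [RHS]scalerBr scalerA mulVf// scale1r /=.
  by rewrite (_ : h%:A = h) ?[h + t]addrC//; exact: mulr1.
split=> [dfl e e0|H].
  have : (fun h => h^-1 *: ((f \o shift t) (h *: 1) - f t)) @ 0^' --> l.
    by case: dfl => df <-.
  move=> /cvgrPdist_le/(_ _ e0) [d /= d0 Hd]; exists d => // h hd.
  have [->|h0] := eqVneq h 0.
    by rewrite addr0 subrr scale0r subr0 !normr0 mulr0.
  have := Hd h; rewrite /= sub0r normrN => /(_ hd h0).
  rewrite mulrC -ler_pdivrMl ?normr_gt0// -normfV -normrZ; apply: le_trans.
  by rewrite -E// distrC.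
have lim : (fun h => h^-1 *: ((f \o shift t) (h *: 1) - f t)) @ 0^' --> l.
  apply/cvgrPdist_le => e e0; have [d d0 Hd] := H _ e0.
  exists d => //= h /=; rewrite sub0r normrN => hd h0.
  have := Hd _ hd; rewrite mulrC -ler_pdivrMl ?normr_gt0// -normfV -normrZ.
  by apply: le_trans; rewrite -E// distrC.
by split; [apply/cvg_ex; exists l|exact/cvg_lim].
Qed.

(** A vector-valued function has no mean value point in general. Instead the growth of [|f t - f a|]
    is compared with that of [phi], with an extra slope [e] that makes the comparison strict and can
    be taken arbitrarily small. *)
Lemma le_mvt_norm (R : realType) (V : normedModType R) (f df : R -> V)
    (phi dphi : R -> R) (a b : R) :
  a <= b -> {within `[a, b], continuous f} -> {within `[a, b], continuous phi} ->
  (forall t, t \in `]a, b[ -> is_derive t 1 f (df t)) ->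
  (forall t, t \in `]a, b[ -> is_derive t 1 phi (dphi t)) ->
  (forall t, t \in `]a, b[ -> `|df t| <= dphi t) ->
  `|f b - f a| <= phi b - phi a.
Proof.
rewrite le_eqVlt => /predU1P[->|ab] cf cphi derf derphi le_df.
  by rewrite !subrr normr0.
apply/ler_addgt0Pr => e0 e0_gt0.
pose e := e0 / (b - a); have e_gt0 : 0 < e by rewrite divr_gt0 ?subr_gt0.
have e0E : e0 = e * b - e * a by rewrite -mulrBr /e divfK// subr_eq0 gt_eqF.
pose psi t := `|f t - f a| - phi t - e * t.
have cpsi : {within `[a, b], continuous psi}.
  move=> x; apply: cvgB; last first.
    apply: cvgM; first exact: cvg_cst.
    exact: (@continuous_subspaceT _ _ _ id (fun x => cvg_id)).
  apply: cvgB; last exact: cphi.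
  by apply: cvg_norm; apply: cvgB; [exact: cf|exact: cvg_cst].
(* At every interior point [psi] decreases strictly just to the right, hence
   its minimum on a segment [[a', b]] with [a < a'] is attained at [b]. *)
have dec t : t \in `]a, b[ -> exists2 d : R, 0 < d & forall h : R, 0 < h -> h < d ->
    psi (t + h) < psi t.
  move=> tab; have e4 : 0 < e / 4 by rewrite divr_gt0.
  have [d1 d10 H1] := (is_derive1P _ _ _).1 (derf _ tab) _ e4.
  have [d2 d20 H2] := (is_derive1P _ _ _).1 (derphi _ tab) _ e4.
  exists (Num.min d1 d2); first by rewrite lt_min d10.
  move=> h h0; rewrite lt_min => /andP[hd1 hd2].
  have nh : `|h| = h by rewrite ger0_norm ?ltW.
  have {H1} := H1 h; rewrite nh => /(_ hd1) H1.
  have {H2} := H2 h; rewrite nh => /(_ hd2); rewrite ler_norml => /andP[H2 _].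
  have K1 : `|f (t + h) - f a| <= `|f t - f a| + e / 4 * h + h * `|df t|.
    have -> : f (t + h) - f a =
        (f t - f a) + (f (t + h) - f t - h *: df t) + h *: df t.
      by rewrite addrA addrNK addrA [f t - f a]addrC [- f a + f t + _]addrAC
        addrK addrC.
    apply: le_trans (ler_normD _ _) _; apply: lerD; last by rewrite normrZ nh.
    by apply: le_trans (ler_normD _ _) _; rewrite lerD2l.
  have K2 : h * `|df t| <= h * dphi t by rewrite ler_pM2l// le_df.
  have K3 : 0 < e * h by rewrite mulr_gt0.
  rewrite /psi; rewrite /GRing.scale/= in H2; lra.
have main a' : a < a' -> a' < b -> psi b <= psi a'.
  move=> aa' a'b; have sub : `[a', b] `<=` `[a, b].
    by move=> x /=; rewrite !in_itv/= => /andP[h ->]; rewrite (le_trans (ltW aa')).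
  have [c + Hc] := EVT_min (ltW a'b) (continuous_subspaceW sub cpsi).
  rewrite in_itv/= => /andP[ac cb].
  have [cb'|bc] := ltP c b; last first.
    have -> : b = c by apply/eqP; rewrite eq_le bc.
    by apply: Hc; rewrite in_itv/= lexx (ltW a'b).
  have cab : c \in `]a, b[ by rewrite in_itv/= cb' (lt_le_trans aa').
  have [d d0 Hd] := dec _ cab.
  pose h := Num.min (d / 2) (b - c).
  have h0 : 0 < h by rewrite lt_min divr_gt0//= subr_gt0.
  have hd : h < d by rewrite /h gt_min ltr_pdivrMr// ltr_pMr// ltr1n.
  have /Hc : c + h \in `[a', b].
    rewrite in_itv/= (le_trans ac) ?lerDl ?(ltW h0)//=.
    by rewrite -lerBrDl /h ge_min lexx orbT.
  by rewrite leNgt Hd.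
(* The endpoint [a] is reached by continuity, since no derivative is given there. *)
have lim : psi x @[x --> a^'+] --> psi a.
  by have /(continuous_within_itvP _ ab)[] := cpsi.
have : psi b <= psi a.
  by apply: (cvgr_to_ge lim); near=> x; apply: main.
rewrite /psi subrr normr0; lra.
Unshelve. all: by end_near. Qed.

(** * Power series with coefficients in a Banach space *)

Lemma series_geometric_bound (R : realType) (V : completeNormedModType R)
    (z : V^nat) (C x : R) :
  0 <= x -> x < 1 -> (forall n, `|z n| <= C * x ^+ n) ->
  cvgn (series z) /\ `|limn (series z)| <= C / (1 - x).
Proof.
move=> x0 x1 le_z.
have nx : `|x| < 1 by rewrite ger0_norm.
have cg := @cvg_geometric_series _ C x nx.
have cn : cvgn [normed series z].
  apply: (@series_le_cvg _ _ (geometric C x)) => //=.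
    by move=> n; apply: le_trans (le_z n).
  exact: is_cvg_geometric_series.
split; first exact: normed_cvg.
apply: le_trans (lim_series_norm cn) _.
rewrite -(cvg_lim _ cg)//; apply: lim_series_le => //.
exact: is_cvg_geometric_series.
Qed.

Lemma is_derive_quadratic (R : realType) (V : normedModType R) (f : R -> V)
    (t : R) (l : V) (d E : R) :
  0 < d -> (forall h, `|h| < d -> `|f (t + h) - f t - h *: l| <= E * h ^+ 2) ->
  is_derive t 1 f l.
Proof.
move=> d0 Hd; apply/is_derive1P => e e0; pose E1 := `|E| + 1.
have E10 : 0 < E1 by rewrite ltr_wpDl.
exists (Num.min d (e / E1)); first by rewrite lt_min d0 divr_gt0.
move=> h; rewrite lt_min => /andP[/Hd hd he]; apply: le_trans hd _.
rewrite -[h ^+ 2]ger0_norm ?sqr_ge0// normrX expr2 mulrA ler_wpM2r//.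
apply: (@le_trans _ _ (E1 * `|h|)).
  by rewrite ler_wpM2r// (le_trans (ler_norm _))// lerDl.
by rewrite mulrC -ler_pdivlMr// ltW.
Qed.

Lemma is_derive_shifted_exprn (R : realType) (K a x : R) (n : nat) :
  is_derive x 1 (fun y => K * (y - a) ^+ n.+1) (K * (n.+1%:R * (x - a) ^+ n)).
Proof.
pose r := `|x - a| + 1.
have r1 : 1 <= r by rewrite lerDr.
have r0 : 0 <= r by exact: le_trans r1.
apply: (@is_derive_quadratic _ _ _ _ _ 1 (`|K| * (n.+1%:R ^+ 2 * r ^+ n.+1))) => // h h1.
rewrite /GRing.scale/=.
have -> : K * (x + h - a) ^+ n.+1 - K * (x - a) ^+ n.+1 -
      h * (K * (n.+1%:R * (x - a) ^+ n)) =
    K * (((x - a) + h) ^+ n.+1 - (x - a) ^+ n.+1 - h * (n.+1%:R * (x - a) ^+ n)).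
  by rewrite [x + h - a]addrAC; ring.
rewrite normrM -mulrA ler_wpM2l// [leRHS]mulrC.
have := @exprn_taylor1 _ (x - a) h r n.+1 r0.
rewrite lerDl ler01 (le_trans (ler_normD _ _)) ?lerD2l ?(ltW h1)//.
by move=> /(_ isT isT); apply: le_trans; rewrite ler_peMr// exprn_ege1.
Qed.

Definition pser (R : realType) (V : completeNormedModType R) (b : V^nat) (t : R) : V :=
  limn (series (fun n => t ^+ n *: b n)).

Section PowerSeries.
Variables (R : realType) (V : completeNormedModType R) (b : V^nat) (C q : R).
Hypotheses (q0 : 0 < q) (le_b : forall n, `|b n| <= C * q ^+ n).

Lemma cvg_pser (t : R) : `|t| * q < 1 ->
  series (fun n => t ^+ n *: b n) @ \oo --> pser b t.
Proof.
move=> tq.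
have [||n|] := @series_geometric_bound _ _ (fun n => t ^+ n *: b n) C (`|t| * q).
- by rewrite mulr_ge0// ltW.
- by [].
- rewrite normrZ normrX exprMn mulrCA ler_wpM2l//; exact: exprn_ge0.
- by [].
Qed.

(** The first-order remainders of the terms add up to at most a constant times [h^2]. Convergence of
    the derived series is a hypothesis because the application gets it, together with its sum, from
    the boundedness of the operator. *)
Lemma is_derive_pser (t : R) (b' : V^nat) :
  (forall n, b' n = n.+1%:R *: b n.+1) -> `|t| * q < 1 ->
  series (fun n => t ^+ n *: b' n) @ \oo --> pser b' t ->
  is_derive t 1 (pser b) (pser b' t).
Proof.
move=> b'E tq cb'.
have tq' : `|t| < q^-1 by rewrite -[q^-1]mul1r ltr_pdivlMr.
(* The midpoint leaves room for [t + h] while [r * q] stays below 1. *)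
pose r := (`|t| + q^-1) / 2.
have qi0 : 0 < q^-1 by rewrite invr_gt0.
have tr : `|t| < r by rewrite /r; lra.
have rq1 : r < q^-1 by rewrite /r; lra.
have r0 : 0 < r by exact: le_lt_trans tr.
have rq0 : 0 <= r * q by rewrite mulr_ge0// ltW.
have rq : r * q < 1 by rewrite -ltr_pdivlMr// mul1r.
(* As [z^4 = r q], the quantity [n^2 (r q)^n] is the square of [n z^n], which is bounded, times the
   summable [(z^2)^n]. *)
pose z := Num.sqrt (Num.sqrt (r * q)).
have z0 : 0 <= z by exact: sqrtr_ge0.
have z4 : z ^+ 4 = r * q.
  by rewrite (exprM _ 2 2) sqr_sqrtr ?sqrtr_ge0// sqr_sqrtr.
have z1 : z < 1 by rewrite -(@expr_lt1 _ 4)// z4.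
have z21 : z ^+ 2 < 1 by rewrite expr_lt1.
have C0 : 0 <= C by have := le_b 0; rewrite expr0 mulr1; apply: le_trans.
pose E := C * (1 - z)^-1 ^+ 2 / r ^+ 2.
apply: (@is_derive_quadratic _ _ _ _ _ (r - `|t|) (E / (1 - z ^+ 2))).
  by rewrite subr_gt0.
move=> h hd.
have thr : `|t + h| <= r by rewrite (le_trans (ler_normD _ _))// ltW// -ltrBrDl.
have thq : `|t + h| * q < 1.
  by apply: le_lt_trans rq; rewrite ler_wpM2r// ltW.
pose w n : V := ((t + h) ^+ n - t ^+ n - h * (n%:R * t ^+ n.-1)) *: b n.
have le_w n : `|w n| <= E * h ^+ 2 * (z ^+ 2) ^+ n.
  rewrite /w normrZ.
  have := exprn_taylor1 n (ltW r0) (ltW tr) thr.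
  rewrite -ler_pdivlMr ?exprn_gt0// => /(ler_wpM2r (normr_ge0 (b n))).
  move/le_trans; apply.
  have nz : (n%:R * z ^+ n) ^+ 2 <= (1 - z)^-1 ^+ 2.
    by rewrite lerXn2r ?nnegrE ?mulr_ge0 ?exprn_ge0 ?invr_ge0 ?subr_ge0 ?(ltW z1)//
      mulrn_exprn_le.
  apply: (@le_trans _ _ (h ^+ 2 * (n%:R ^+ 2 * r ^+ n) / r ^+ 2 * (C * q ^+ n))).
    apply: ler_wpM2l => //.
    have rn0 := exprn_ge0 n (ltW r0).
    exact: divr_ge0 (mulr_ge0 (sqr_ge0 h) (mulr_ge0 (sqr_ge0 _) rn0)) (sqr_ge0 r).
  have -> : h ^+ 2 * (n%:R ^+ 2 * r ^+ n) / r ^+ 2 * (C * q ^+ n) =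
      (h ^+ 2 / r ^+ 2 * C) * ((n%:R * z ^+ n) ^+ 2 * (z ^+ 2) ^+ n).
    have -> : (n%:R * z ^+ n) ^+ 2 * (z ^+ 2) ^+ n = n%:R ^+ 2 * (r ^+ n * q ^+ n).
      have -> : r ^+ n * q ^+ n = z ^+ (4 * n) by rewrite -exprMn -z4 exprM.
      rewrite exprMn -mulrA -!exprM -exprD.
      by rewrite [(n * 2)%N]mulnC -mulnDl.
    rewrite -!mulrA; ring.
  have -> : E * h ^+ 2 * (z ^+ 2) ^+ n =
      (h ^+ 2 / r ^+ 2 * C) * ((1 - z)^-1 ^+ 2 * (z ^+ 2) ^+ n).
    by rewrite /E; ring.
  apply: ler_wpM2l.
    exact: mulr_ge0 (divr_ge0 (sqr_ge0 h) (sqr_ge0 r)) C0.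
  by apply: ler_wpM2r => //; rewrite !exprn_ge0.
have [cw] := series_geometric_bound (sqr_ge0 z) z21 le_w.
have -> : limn (series w) = pser b (t + h) - pser b t - h *: pser b' t.
  apply: cvg_lim => //.
  have -> : series w = (fun n => series (fun n => (t + h) ^+ n *: b n) n -
      series (fun n => t ^+ n *: b n) n -
      h *: series (fun n => (n%:R * t ^+ n.-1) *: b n) n).
    apply/funext => n; rewrite /series /= scaler_sumr -!sumrB.
    by apply: eq_bigr => i _; rewrite /w !scalerBl !scalerA.
  apply: cvgB; first by apply: cvgB; exact: cvg_pser.
  apply: cvgZ; first exact: cvg_cst.
  (* The term of index 0 has the factor [n = 0]; without it the series is the one of [b']. *)
  rewrite -cvg_shiftS.
  have -> : [sequence series (fun n => (n%:R * t ^+ n.-1) *: b n) n.+1]_n =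
      series (fun n => t ^+ n *: b' n).
    apply/funext => n; rewrite /series /= big_nat_recl// mul0r scale0r add0r.
    by apply: eq_bigr => i _; rewrite b'E scalerA mulrC.
  exact: cb'.
by move/le_trans; apply; rewrite mulrAC.
Qed.

End PowerSeries.

(** * Operators on a scale *)

Section Scale.
Variables (R : realType) (s0 : R) (B : banach_scale s0).
Implicit Types (s c t M : R) (v : ambient B) (T A : ambient B -> ambient B).

(** Only vectors of [ambient] can be compared across indices, so membership and the norm bound are
    stated together about them. *)
Definition norm_le s v c := exists2 y : B s, emb B s y = v & `|y| <= c.

(* [0] is a junk value, taken when [v] is not in the space of index [s]. *)
Definition scale_lift s v : B s := xget 0 [set y : B s | emb B s y = v].

Lemma norm_le_ge0 s v c : norm_le s v c -> 0 <= c.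
Proof. by case=> y _; apply: le_trans. Qed.

Lemma norm_le_weaken s v c c' : c <= c' -> norm_le s v c -> norm_le s v c'.
Proof. by move=> cc' [y yv yc]; exists y => //; apply: le_trans cc'. Qed.

Lemma norm_le_emb s (y : B s) : norm_le s (emb B s y) `|y|.
Proof. by exists y. Qed.

Lemma norm_le_normr s (y : B s) c : 0 < s -> s <= s0 ->
  norm_le s (emb B s y) c -> `|y| <= c.
Proof. by move=> sgt0 ss0 [z zy]; rewrite (emb_inj sgt0 ss0 zy). Qed.

Lemma norm_leD s v v' c c' :
  norm_le s v c -> norm_le s v' c' -> norm_le s (v + v') (c + c').
Proof.
move=> [y <- yc] [y' <- yc']; exists (y + y'); first by rewrite linearD.
by rewrite (le_trans (ler_normD _ _))// lerD.
Qed.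

Lemma norm_le_sub s' s'' v c : 0 < s' -> s' <= s'' -> s'' <= s0 ->
  norm_le s'' v c -> norm_le s' v c.
Proof.
move=> s'0; rewrite le_eqVlt => /predU1P[->//|s's''] s''s0 [y <- yc].
by have [x xy xley] := emb_sub s'0 s's'' s''s0 y; exists x => //; apply: le_trans yc.
Qed.

Lemma emb_lift s v c : norm_le s v c -> emb B s (scale_lift s v) = v.
Proof.
by move=> [y yv _]; apply: (@xgetPex _ 0 [set y : B s | emb B s y = v]); exists y.
Qed.

Lemma normr_lift s v c : 0 < s -> s <= s0 -> norm_le s v c -> `|scale_lift s v| <= c.
Proof.
by move=> sgt0 ss0 vc; apply: norm_le_normr => //; rewrite (emb_lift vc).
Qed.

Lemma bounded_on_scale_norm_le T s'' s' C v c : 0 <= C ->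
  bounded_on_scale T s'' s' C -> norm_le s'' v c -> norm_le s' (T v) (C * c).
Proof.
move=> C0 bd [y <- yc]; have [z zy zle] := bd y; exists z => //.
by rewrite (le_trans zle)// ler_wpM2l.
Qed.

Lemma linear_on_scaleB T s'' s' (x y : B s'') : linear_on_scale T s'' s' ->
  T (emb B s'' (x - y)) = T (emb B s'' x) - T (emb B s'' y).
Proof.
by move=> [_ /(_ (-1) y x)]; rewrite !scaleN1r [- y + x]addrC => ->; rewrite addrC.
Qed.

Lemma linear_on_scale0 T s'' s' : linear_on_scale T s'' s' -> T 0 = 0.
Proof.
move=> lin; have := linear_on_scaleB 0 0 lin.
by rewrite subrr linear0 subrr.
Qed.

Lemma linear_on_scaleZ T s'' s' k (x : B s'') : linear_on_scale T s'' s' ->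
  T (k *: emb B s'' x) = k *: T (emb B s'' x).
Proof.
move=> lin; have [_ /(_ k x 0)] := lin.
by rewrite addr0 !linear0 (linear_on_scale0 lin) addr0 linearZ.
Qed.

Lemma linear_on_scale_series T s'' s' (z : (B s'')^nat) (z' : (B s')^nat) :
  linear_on_scale T s'' s' -> (forall n, emb B s' (z' n) = T (emb B s'' (z n))) ->
  forall n, emb B s' (series z' n) = T (emb B s'' (series z n)).
Proof.
move=> lin zz'; elim=> [|n IH].
  by rewrite /series /= !big_geq// !linear0 (linear_on_scale0 lin).
have [_ /(_ 1)] := lin; rewrite /series /= !big_nat_recr//= => {}lin.
rewrite -[X in T (emb B s'' (X + _))]scale1r lin scale1r -zz' -IH.
by rewrite linearD.
Qed.

(** By linearity partial sums go to partial sums, and a bounded map is continuous. *)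
Lemma cvg_series_bounded T s'' s' C (z : (B s'')^nat) (z' : (B s')^nat) (y : B s'') :
  0 < s' -> s' <= s0 -> 0 <= C ->
  linear_on_scale T s'' s' -> bounded_on_scale T s'' s' C ->
  (forall n, emb B s' (z' n) = T (emb B s'' (z n))) ->
  series z @ \oo --> y ->
  exists2 y' : B s', emb B s' y' = T (emb B s'' y) & series z' @ \oo --> y'.
Proof.
move=> s'0 s's0 C0 lin bd zz' cz; have [y' y'y _] := bd y; exists y' => //.
have ser := linear_on_scale_series lin zz'.
have le_dist n : `|y' - series z' n| <= C * `|y - series z n|.
  apply: norm_le_normr => //; rewrite linearB /= y'y ser -(linear_on_scaleB _ _ lin).
  exact: bounded_on_scale_norm_le (norm_le_emb _).
apply/cvgrPdist_le => e e0.
have C1 : 0 < C + 1 by rewrite ltr_wpDl.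
have /cvgrPdist_le/(_ (e / (C + 1)))/(_ (divr_gt0 e0 C1)) := cz.
apply: filterS => n; rewrite ler_pdivlMr// mulrC => h.
apply: le_trans (le_dist n) (le_trans _ h).
by rewrite ler_wpM2r// lerDl.
Qed.

(** Inclusions are treated as operators, so that [cvg_series_bounded] also compares one series in
    two spaces. *)
Lemma linear_on_scale_id s'' s' : 0 < s' -> s' < s'' -> s'' <= s0 ->
  linear_on_scale (idfun : ambient B -> ambient B) s'' s'.
Proof.
move=> s'0 s's'' s''s0; split=> [x|a x y].
  by have [z zx _] := emb_sub s'0 s's'' s''s0 x; exists z.
by rewrite /= linearP.
Qed.

Lemma bounded_on_scale_id s'' s' : 0 < s' -> s' < s'' -> s'' <= s0 ->
  bounded_on_scale (idfun : ambient B -> ambient B) s'' s' 1.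
Proof.
move=> s'0 s's'' s''s0 x.
by have [z zx zle] := emb_sub s'0 s's'' s''s0 x; exists z; rewrite ?mul1r.
Qed.

(** The upper index [s1] is a parameter: existence takes [s0], uniqueness the index in which the
    solutions live. *)
Definition scale_operator A M s s1 := forall s' s'', s <= s' -> s' < s'' -> s'' <= s1 ->
  linear_on_scale A s'' s' /\ bounded_on_scale A s'' s' (M / (s'' - s')).

Lemma norm_le_iter A M s s1 v c : 0 < s -> s1 <= s0 -> 0 <= M ->
  scale_operator A M s s1 -> norm_le s1 v c ->
  forall n s', s <= s' -> s' < s1 ->
  norm_le s' (iter n A v) (c * (expR 1 * M / (s1 - s')) ^+ n * n`!%:R).
Proof.
move=> sgt0 s1s0 M0 opA vc n s' ss' s's1.
have s'0 : 0 < s' by exact: lt_le_trans ss'.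
have c0 := norm_le_ge0 vc.
have d0 : 0 < s1 - s' by rewrite subr_gt0.
(* The equal steps have size [(s1 - s') / n], which needs [n > 0]; for [n = 0] the inclusion
   suffices. *)
case: n => [|n].
  rewrite expr0 !mulr1 /=; exact: norm_le_sub (ltW s's1) _ vc.
pose h := (s1 - s') / n.+1%:R.
have h0 : 0 < h by rewrite divr_gt0.
have hE : n.+1%:R * h = s1 - s' by rewrite /h mulrCA divff ?mulr1// pnatr_eq0.
have step k : (k <= n.+1)%N ->
    norm_le (s1 - k%:R * h) (iter k A v) (c * (M / h) ^+ k).
  elim: k => [|k IH] kn; first by rewrite mul0r subr0 expr0 mulr1.
  have -> : c * (M / h) ^+ k.+1 = M / h * (c * (M / h) ^+ k).
    by rewrite exprS mulrCA.
  have kh : k.+1%:R * h <= s1 - s' by rewrite -hE ler_wpM2r ?ler_nat// ltW.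
  have kh0 : 0 <= k%:R * h by rewrite mulr_ge0// ltW.
  have kE : k.+1%:R * h = k%:R * h + h by rewrite -natr1 mulrDl mul1r.
  rewrite iterS; apply: bounded_on_scale_norm_le (IH (ltnW kn)).
    by rewrite divr_ge0// ltW.
  (* The constant [M / h] must display the difference of the two indices. The rewriting also hits
     [h] inside the indices, which the next two rewritings restore. *)
  have -> : h = s1 - k%:R * h - (s1 - k.+1%:R * h) by rewrite kE; ring.
  have -> : s1 - k%:R * (s1 - k%:R * h - (s1 - k.+1%:R * h)) = s1 - k%:R * h.
    by rewrite kE; ring.
  have -> : s1 - k.+1%:R * (s1 - k%:R * h - (s1 - k.+1%:R * h)) = s1 - k.+1%:R * h.
    by rewrite kE; ring.
  by apply: (opA _ _ _ _ _).2; lra.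
have {step} := step _ (leqnn _); rewrite hE subKr.
apply: norm_le_weaken; rewrite -mulrA ler_wpM2l//.
have -> : M / h = n.+1%:R * (M / (s1 - s')) by rewrite /h invf_div; ring.
rewrite -[expR 1 * M / _]mulrA.
have : 0 <= M / (s1 - s') by rewrite divr_ge0// ltW.
move: (M / (s1 - s')) => g g0; rewrite !exprMn mulrAC.
by rewrite ler_wpM2r ?exprn_le_fact_expR// exprn_ge0.
Qed.

End Scale.

(** * Uniqueness of solutions *)

Section Uniqueness.
Variables (R : realType) (s0 : R) (B : banach_scale s0).
Implicit Types (s c t M : R) (A : ambient B -> ambient B).

Lemma is_derive_incl s' s'' (w : R -> B s'') (W : R -> B s') t (l : B s'') (L : B s') :
  0 < s' -> s' < s'' -> s'' <= s0 ->
  (forall x, emb B s' (W x) = emb B s'' (w x)) -> emb B s' L = emb B s'' l ->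
  is_derive t 1 w l -> is_derive t 1 W L.
Proof.
move=> s'0 s's'' s''s0 Ww Ll /is_derive1P dw; apply/is_derive1P => e e0.
have [d d0 Hd] := dw _ e0; exists d => // h /Hd; apply: le_trans.
apply: norm_le_normr => //; first exact: ltW (lt_le_trans s's'' s''s0).
apply: (norm_le_sub s'0 (ltW s's'') s''s0).
rewrite !linearB linearZ /= !Ww Ll -linearZ -!linearB.
exact: norm_le_emb.
Qed.

Lemma continuous_incl s' s'' (w : R -> B s'') (W : R -> B s') (D : set R) :
  0 < s' -> s' < s'' -> s'' <= s0 ->
  (forall x, emb B s' (W x) = emb B s'' (w x)) ->
  {within D, continuous w} -> {within D, continuous W}.
Proof.
move=> s'0 s's'' s''s0 Ww cw x; apply/cvgrPdist_le => e e0.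
have /cvgrPdist_le/(_ e e0) := cw x; apply: filterS => y; apply: le_trans.
apply: norm_le_normr => //; first exact: ltW (lt_le_trans s's'' s''s0).
apply: (norm_le_sub s'0 (ltW s's'') s''s0).
rewrite !linearB /= !Ww -!linearB; exact: norm_le_emb.
Qed.

Lemma norm_within_bounded (V : normedModType R) (w : R -> V) (a b : R) :
  a <= b -> {within `[a, b], continuous w} ->
  exists2 m, 0 <= m & forall t, t \in `[a, b] -> `|w t| <= m.
Proof.
move=> ab cw.
have cn : {within `[a, b], continuous (fun t => `|w t|)}.
  by move=> x; apply: cvg_norm; exact: cw.
by have [c _ Hc] := EVT_max ab cn; exists `|w c|.
Qed.

(* Each passage from [s''] to a smaller [s'] costs a factor [M / (s'' - s')]
   and integrates once more in time: [n] passages of size [(s1 - s) / n]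
   bound [w] by a constant times the [n]-th power of
   [exp(1) M (b - a) / (s1 - s) < 1]. *)
Lemma homogeneous_solution_eq0 A M s s1 (w dw : R -> B s1) (a b : R) :
  0 < s -> s < s1 -> s1 <= s0 -> 0 <= M -> scale_operator A M s s1 ->
  a <= b -> expR 1 * M * (b - a) < s1 - s ->
  {within `[a, b], continuous w} -> w a = 0 ->
  (forall t, t \in `]a, b[ -> is_derive t 1 w (dw t)) ->
  (forall t, t \in `]a, b[ -> emb B s1 (dw t) = A (emb B s1 (w t))) ->
  forall t, t \in `[a, b] -> w t = 0.
Proof.
move=> sgt0 ss1 s1s0 M0 opA ab small cw wa dW Aw.
have [m m0 wm] := norm_within_bounded ab cw.
have d0 : 0 < s1 - s by rewrite subr_gt0.
(* Of [n] passages in all, [k] have been made; each integration in time raises the power of [t - a]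
   and supplies one factor of the factorial. *)
have step n k : (k <= n)%N -> (0 < n)%N -> forall t, t \in `[a, b] ->
    norm_le (s1 - k%:R * ((s1 - s) / n%:R)) (emb B s1 (w t))
      (m * (M / ((s1 - s) / n%:R)) ^+ k / k`!%:R * (t - a) ^+ k).
  move=> + n0; set h := (s1 - s) / n%:R.
  have h0 : 0 < h by rewrite divr_gt0// ltr0n.
  have nh : n%:R * h = s1 - s.
    by rewrite /h mulrCA divff ?mulr1// pnatr_eq0 -lt0n.
  elim: k => [|k IH] kn t tab.
    rewrite mul0r subr0 !expr0 !mulr1 fact0 divr1.
    by exists (w t) => //; exact: wm.
  have kh : k.+1%:R * h <= s1 - s by rewrite -nh ler_wpM2r ?ler_nat// ltW.
  have kh0 : 0 <= k%:R * h by rewrite mulr_ge0// ltW.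
  have kE : k.+1%:R * h = k%:R * h + h by rewrite -natr1 mulrDl mul1r.
  pose s'' := s1 - k%:R * h; pose s' := s1 - k.+1%:R * h.
  have ss' : s <= s' by rewrite /s'; lra.
  have s'0 : 0 < s' by exact: lt_le_trans ss'.
  have s's'' : s' < s'' by rewrite /s' /s'' kE; lra.
  have s''s1 : s'' <= s1 by rewrite /s''; lra.
  have hE : s'' - s' = h by rewrite /s'' /s' kE; ring.
  have s's1 : s' < s1 by exact: lt_le_trans s''s1.
  have s's0 : s' <= s0 by rewrite ltW// (lt_le_trans s's1).
  have [_ bdA] := opA _ _ ss' s's'' s''s1.
  have embJ (x : B s1) : emb B s' (scale_lift s' (emb B s1 x)) = emb B s1 x.
    exact: emb_lift (norm_le_sub s'0 (ltW s's1) s1s0 (norm_le_emb x)).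
  pose W x := scale_lift s' (emb B s1 (w x)).
  pose dWs x := scale_lift s' (emb B s1 (dw x)).
  pose K := m * (M / h) ^+ k.+1 / k.+1`!%:R.
  have sub : `[a, t] `<=` `[a, b].
    move: tab; rewrite in_itv/= => /andP[_ tb] x /=.
    by rewrite !in_itv/= => /andP[-> xt]; exact: le_trans tb.
  have subo x : x \in `]a, t[ -> x \in `]a, b[.
    move: tab; rewrite !in_itv/= => /andP[_ tb] /andP[-> xt].
    exact: lt_le_trans tb.
  have subc x : x \in `]a, b[ -> x \in `[a, b].
    by rewrite !in_itv/= => /andP[/ltW-> /ltW->].
  have at_ : a <= t by move: tab; rewrite in_itv/= => /andP[].
  (* [phi] is the antiderivative, vanishing at [a], of [M / h] times the previous bound; the mean
     value inequality against it plays the part of the integration in time. *)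
  pose phi (x : R) : R := K * (x - a) ^+ k.+1.
  have dphi (x : R) : is_derive x (1 : R) phi (M / h * (m * (M / h) ^+ k / k`!%:R * (x - a) ^+ k)).
    have -> : M / h * (m * (M / h) ^+ k / k`!%:R * (x - a) ^+ k) =
        K * (k.+1%:R * (x - a) ^+ k).
      rewrite /K factS natrM exprS.
      have kf : k`!%:R != 0 :> R by rewrite pnatr_eq0 -lt0n fact_gt0.
      have k1 : k.+1%:R != 0 :> R by rewrite pnatr_eq0.
      move: (M / h) kf k1 => g kf k1; field.
      by rewrite kf nat1r.
    exact: is_derive_shifted_exprn.
  have : `|W t - W a| <= phi t - phi a.
    apply: (@le_mvt_norm _ _ W dWs phi
      (fun x => M / h * (m * (M / h) ^+ k / k`!%:R * (x - a) ^+ k)) a t) => //.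
    - apply: (continuous_incl s'0 s's1 s1s0 (fun x => embJ (w x))).
      exact: continuous_subspaceW sub cw.
    - by apply: derivable_within_continuous => x _; have [] := dphi x.
    - move=> x /subo xab.
      exact: is_derive_incl s'0 s's1 s1s0 (fun x => embJ (w x)) (embJ (dw x)) (dW _ xab).
    - move=> x /subo xab; apply: norm_le_normr => //.
      rewrite /dWs embJ Aw//.
      apply: bounded_on_scale_norm_le (IH (ltnW kn) _ (subc _ xab)).
        by rewrite divr_ge0// ltW.
      by rewrite -[X in M / X]hE.
  rewrite /phi subrr expr0n /= mulr0 subr0.
  have -> : W a = 0.
    apply: (emb_inj s'0 s's0).
    by rewrite embJ wa !linear0.
  by rewrite subr0 => Wt; exists (W t) => //; exact: embJ.
move=> t tab.
have /andP[at_ tb] : a <= t <= b by move: tab; rewrite in_itv.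
pose x := expR 1 * M * (b - a) / (s1 - s).
have x0 : 0 <= x.
  by rewrite divr_ge0 ?(ltW d0)// !mulr_ge0 ?expR_ge0 ?subr_ge0.
have x1 : x < 1 by rewrite /x ltr_pdivrMr// mul1r.
have ss0 : s <= s0 by rewrite ltW// (lt_le_trans ss1).
have Ew : emb B s (scale_lift s (emb B s1 (w t))) = emb B s1 (w t).
  exact: emb_lift (norm_le_sub sgt0 (ltW ss1) s1s0 (norm_le_emb (w t))).
(* After [n.+1] passages out of [n.+1] the index is exactly [s], and the factorial compensates the
   growth of [n.+1 ^ n.+1]. *)
have le_n n : `|scale_lift s (emb B s1 (w t))| <= geometric m x n.+1.
  apply: norm_le_normr => //; rewrite Ew.
  have := step n.+1 n.+1 (leqnn _) isT t tab.
  have -> : s1 - n.+1%:R * ((s1 - s) / n.+1%:R) = s.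
    by rewrite mulrCA divff ?mulr1 ?subKr// pnatr_eq0.
  apply: norm_le_weaken; rewrite /=.
  have -> : M / ((s1 - s) / n.+1%:R) = n.+1%:R * (M / (s1 - s)).
    by rewrite invf_div; ring.
  have -> : x = expR 1 * (M / (s1 - s)) * (b - a) by rewrite /x; ring.
  have : 0 <= M / (s1 - s) by rewrite divr_ge0// ltW.
  move: (M / (s1 - s)) => g g0; rewrite !exprMn -!mulrA ler_wpM2l//.
  have f0 : 0 < n.+1`!%:R :> R by rewrite ltr0n fact_gt0.
  have -> : n.+1%:R ^+ n.+1 * (g ^+ n.+1 * (n.+1`!%:R^-1 * (t - a) ^+ n.+1)) =
      (n.+1%:R ^+ n.+1 / n.+1`!%:R) * (g ^+ n.+1 * (t - a) ^+ n.+1) by ring.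
  apply: ler_pM.
  - by rewrite divr_ge0// exprn_ge0.
  - by rewrite mulr_ge0// exprn_ge0// subr_ge0.
  - by rewrite ler_pdivrMr// exprn_le_fact_expR.
  - by rewrite ler_wpM2l ?exprn_ge0// lerXn2r ?nnegrE ?subr_ge0// lerB.
have : `|scale_lift s (emb B s1 (w t))| <= 0.
  apply: (cvgr_to_ge (@cvg_geometric _ m x _)); first by rewrite ger0_norm.
  exists 1%N => // -[//|n] _; exact: le_n.
(* Vanishing in the larger space of index [s] is vanishing in [ambient], hence in [B s1] by
   injectivity. *)
rewrite normr_le0 => /eqP E; apply: (emb_inj (lt_trans sgt0 ss1) s1s0).
by rewrite -Ew E !linear0.
Qed.

End Uniqueness.

Section UniqueSolution.
Variables (R : realType) (s0 : R) (B : banach_scale s0).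

(** The operator need not be bounded in [B s], so the difference is measured at the index [s1]. The
    resulting time step [tau] depends on [s], [s1] and [M] only, and finitely many steps reach any
    time before [T]. *)
Lemma is_solution_unique (A : ambient B -> ambient B) (M s1 s T : R) (u0 : B s0)
    (u v : R -> B s) :
  0 < s1 -> s1 < s -> s <= s0 -> 0 < M -> scale_operator A M s1 s ->
  is_solution A u0 T u -> is_solution A u0 T v ->
  forall t : R, t \in `[0, T[ -> v t = u t.
Proof.
move=> s10 s1s ss0 M0 opA [cu [du _] _ Au u0E] [cv [dv _] _ Av v0E].
have [lin _] := opA _ _ (lexx s1) s1s (lexx s).
pose w (t : R) : B s := v t - u t.
have w0 : w 0 = 0.
  by apply/eqP; rewrite subr_eq0; apply/eqP/(emb_inj (lt_trans s10 s1s) ss0); rewrite v0E.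
have cw : {within `[0, T[, continuous w}.
  by move=> x; apply: cvgB; [exact: cv|exact: cu].
have dw (t : R) : t \in `]0, T[ -> is_derive t 1 w (derive1 v t - derive1 u t).
  move=> tT; rewrite !derive1E.
  by apply: is_deriveB; apply: DeriveDef => //; [exact: dv|exact: du].
have Aw (t : R) : t \in `]0, T[ -> emb B s (derive1 v t - derive1 u t) = A (emb B s (w t)).
  by move=> tT; rewrite linearB /= Au// Av// (linear_on_scaleB _ _ lin).
(* The factor 2 makes [exp(1) M tau] half of [s - s1], hence strictly smaller, as
   [homogeneous_solution_eq0] requires. *)
pose tau := (s - s1) / (2 * (expR 1 * M)).
have eM0 : 0 < expR 1 * M by rewrite mulr_gt0// expR_gt0.
have tau0 : 0 < tau by rewrite divr_gt0 ?subr_gt0// mulr_gt0.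
have main (j : nat) (t : R) : t \in `[0, T[ -> t <= j%:R * tau -> w t = 0.
  elim: j t => [|j IH] t tT tj.
    suff -> : t = 0 by [].
    by apply/eqP; rewrite eq_le -[X in _ <= X](mul0r tau) tj; move: tT; rewrite in_itv/= => /andP[].
  have [/(IH _ tT)//|jt] := leP t (j%:R * tau).
  have /andP[t0 tltT] : 0 <= t < T by move: tT; rewrite in_itv.
  have j0 : 0 <= j%:R * tau by rewrite mulr_ge0// ltW.
  have jT : j%:R * tau \in `[0, T[ by rewrite in_itv/= j0 (lt_trans jt).
  have sub (x : R) : x \in `](j%:R * tau), t[ -> x \in `]0, T[.
    rewrite !in_itv/= => /andP[jx xt].
    by rewrite (le_lt_trans j0)//= (lt_trans xt).
  have small : expR 1 * M * (t - j%:R * tau) < s - s1.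
    apply: (@le_lt_trans _ _ (expR 1 * M * tau)).
      by rewrite ler_pM2l// lerBlDl; move: tj; rewrite -natr1; lra.
    have -> : expR 1 * M * tau = (s - s1) / 2.
      by rewrite /tau; field; rewrite gt_eqF ?expR_gt0//= gt_eqF.
    by rewrite ltr_pdivrMr// ltr_pMr ?subr_gt0// ltr1n.
  have cw' : {within `[(j%:R * tau), t], continuous w}.
    apply: continuous_subspaceW cw => x /=; rewrite !in_itv/= => /andP[jx xt].
    by rewrite (le_trans j0)//= (le_lt_trans xt).
  have eq0 := homogeneous_solution_eq0 s10 s1s ss0 (ltW M0) opA (ltW jt) small cw'
    (IH _ jT (lexx _)) (fun x xj => dw x (sub x xj)) (fun x xj => Aw x (sub x xj)).
  by apply: eq0; rewrite in_itv/= lexx ltW.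
move=> t tT; apply/eqP; rewrite -subr_eq0; apply/eqP.
apply: (main (Num.truncn (t / tau)).+1 _ tT).
by rewrite -ler_pdivrMr// ltW// truncnS_gt.
Qed.

End UniqueSolution.

(** * Existence by the Taylor series in time *)

Section PowerSeriesSolution.
Variables (R : realType) (s0 : R) (B : banach_scale s0).

(** These are the coefficients of the formal series [exp(t A) u0]; [emb_taylor_coef] rules out the
    junk value of [scale_lift]. *)
Definition taylor_coef (A : ambient B -> ambient B) (u0 : B s0) (s : R) (n : nat) : B s :=
  n`!%:R^-1 *: scale_lift s (iter n A (emb B s0 u0)).

Variables (A : ambient B -> ambient B) (M s : R) (u0 : B s0).
Hypotheses (sgt0 : 0 < s) (M0 : 0 < M) (opA : scale_operator A M s s0).

(** The inverse of [rate s'] is a lower bound for the radius of convergence at the index [s'];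
    [dcoef] is the termwise derivative of the series. *)
Let rate s' := expR 1 * M / (s0 - s').
Let sol s' := pser (taylor_coef A u0 s').
Let dcoef s' n := n.+1%:R *: taylor_coef A u0 s' n.+1.

Let norm_le_iterA n s' : s <= s' -> s' < s0 ->
  norm_le s' (iter n A (emb B s0 u0)) (`|u0| * rate s' ^+ n * n`!%:R).
Proof.
move=> ss' s's0.
by apply: (norm_le_iter sgt0 (lexx s0) (ltW M0) opA (norm_le_emb u0)).
Qed.

Lemma emb_taylor_coef n s' : s <= s' -> s' < s0 ->
  emb B s' (taylor_coef A u0 s' n) = n`!%:R^-1 *: iter n A (emb B s0 u0).
Proof. by move=> ss' s's0; rewrite linearZ /= (emb_lift (norm_le_iterA n ss' s's0)). Qed.

Lemma norm_taylor_coef n s' : s <= s' -> s' < s0 ->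
  `|taylor_coef A u0 s' n| <= `|u0| * (expR 1 * M / (s0 - s')) ^+ n.
Proof.
move=> ss' s's0; have f0 : 0 < n`!%:R :> R by rewrite ltr0n fact_gt0.
rewrite normrZ ger0_norm ?invr_ge0 ?(ltW f0)// mulrC ler_pdivrMr//.
by apply: normr_lift (norm_le_iterA n ss' s's0); [exact: lt_le_trans ss'|exact: ltW].
Qed.

Let rate_gt0 s' : s' < s0 -> 0 < rate s'.
Proof. by move=> s's0; rewrite divr_gt0 ?subr_gt0// mulr_gt0// expR_gt0. Qed.

Let cvg_sol s' (t : R) : s <= s' -> s' < s0 -> `|t| * rate s' < 1 ->
  series (fun n => t ^+ n *: taylor_coef A u0 s' n) @ \oo --> sol s' t.
Proof.
move=> ss' s's0 tr; apply: (cvg_pser (rate_gt0 s's0) _ tr) => n.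
exact: norm_taylor_coef.
Qed.

Let ratio_lt1 s' (t : R) : s' < s0 -> (`|t| * rate s' < 1) = (`|t| * (expR 1 * M) < s0 - s').
Proof. by move=> s's0; rewrite mulrA ltr_pdivrMr ?subr_gt0// mul1r. Qed.

(** Both series have the same terms in [ambient], and the inclusion is continuous. *)
Let sol_incl s' s'' (t : R) : s <= s' -> s' < s'' -> s'' < s0 -> `|t| * rate s'' < 1 ->
  emb B s' (sol s' t) = emb B s'' (sol s'' t).
Proof.
move=> ss' s's'' s''s0 tr.
have s'0 : 0 < s' by exact: lt_le_trans ss'.
have s's0 := lt_trans s's'' s''s0.
have ss'' := le_trans ss' (ltW s's'').
have [|y /= yE cy] := cvg_series_bounded (z' := fun n => t ^+ n *: taylor_coef A u0 s' n)
  s'0 (ltW s's0) ler01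
  (@linear_on_scale_id _ _ B _ _ s'0 s's'' (ltW s''s0))
  (@bounded_on_scale_id _ _ B _ _ s'0 s's'' (ltW s''s0)) _ (cvg_sol ss'' s''s0 tr).
  by move=> n; rewrite linearZ /= emb_taylor_coef// [RHS]linearZ /= emb_taylor_coef.
by rewrite -yE; congr (emb B s' _); exact: cvg_lim cy.
Qed.

(** [A] sends the [n]-th term of the series at index [s''] to the [n]-th term of the derived series
    at index [s'], and it commutes with the sum since it is bounded between these spaces. *)
Let is_derive_sol s' s'' (t : R) : s <= s' -> s' < s'' -> s'' < s0 -> `|t| * rate s'' < 1 ->
  is_derive t 1 (sol s') (pser (dcoef s') t) /\
  emb B s' (pser (dcoef s') t) = A (emb B s'' (sol s'' t)).
Proof.
move=> ss' s's'' s''s0 tr.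
have s'0 : 0 < s' by exact: lt_le_trans ss'.
have s's0 := lt_trans s's'' s''s0.
have ss'' := le_trans ss' (ltW s's'').
have [lin bd] := opA ss' s's'' (ltW s''s0).
have d0 : 0 <= M / (s'' - s') by rewrite divr_ge0 ?subr_ge0 ?ltW.
have dcoefE n : emb B s' (dcoef s' n) = A (emb B s'' (taylor_coef A u0 s'' n)).
  rewrite [LHS]linearZ /= emb_taylor_coef// scalerA [taylor_coef A u0 s'' n]/taylor_coef.
  rewrite linearZ /= (linear_on_scaleZ _ _ lin) (emb_lift (norm_le_iterA n ss'' s''s0)).
  by rewrite factS natrM invfM mulVKf// pnatr_eq0.
have [|y yE cy] := cvg_series_bounded (z' := fun n => t ^+ n *: dcoef s' n)
    s'0 (ltW s's0) d0 lin bd _ (cvg_sol ss'' s''s0 tr).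
  move=> n; rewrite [LHS]linearZ /= dcoefE.
  by rewrite [emb B s'' (t ^+ n *: _)]linearZ /= (linear_on_scaleZ _ _ lin).
have yd : y = pser (dcoef s') t by apply/esym; exact: cvg_lim cy.
split; last by rewrite -yd.
have tr' : `|t| * rate s' < 1.
  by move: tr; rewrite !ratio_lt1// => /lt_trans; apply; rewrite ltrD2l ltrN2.
apply: (is_derive_pser (rate_gt0 s's0) (C := `|u0|)) => //.
- by move=> n; exact: norm_taylor_coef.
- by rewrite -yd.
Qed.

Let room (s' t : R) : `|t| * (expR 1 * M) < s0 - s' ->
  exists s'' : R, [/\ s' < s'', s'' < s0 & `|t| * (expR 1 * M) < s0 - s''].
Proof.
move=> tM; have t0 : 0 <= `|t| * (expR 1 * M).
  by rewrite mulr_ge0// ltW// mulr_gt0// expR_gt0.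
(* The midpoint of [s'] and [s0 - |t| exp(1) M], below which the index must stay at time [t]. *)
exists ((s' + (s0 - `|t| * (expR 1 * M))) / 2).
split; lra.
Qed.

(* [A u] is computed in a space of index slightly larger than [s], in which the
   power series still converges, because [A] is unbounded in [B s]. *)
Lemma is_solution_pser : s < s0 ->
  is_solution A u0 ((expR 1 * M)^-1 * (s0 - s)) (pser (taylor_coef A u0 s)).
Proof.
move=> ss0.
have eM0 : 0 < expR 1 * M by rewrite mulr_gt0// expR_gt0.
set T := (expR 1 * M)^-1 * (s0 - s).
have small (t : R) : t \in `[0, T[ -> `|t| * (expR 1 * M) < s0 - s.
  rewrite in_itv/= => /andP[t0 tT]; rewrite ger0_norm//.
  by move: tT; rewrite /T ltr_pdivlMl// mulrC.
have oc (t : R) : t \in `]0, T[ -> t \in `[0, T[.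
  by rewrite !in_itv/= => /andP[/ltW-> ->].
have derE (t : R) : `|t| * (expR 1 * M) < s0 - s ->
    is_derive t 1 (sol s) (pser (dcoef s) t) /\
    emb B s (pser (dcoef s) t) = A (emb B s (sol s t)).
  move=> /room[s'' [ss'' s''s0 ts'']]; move: ts''; rewrite -ratio_lt1// => ts''.
  rewrite (sol_incl (lexx s) ss'' s''s0 ts'').
  exact: (is_derive_sol (lexx s) ss'' s''s0 ts'').
have derE1 (t : R) : `|t| * (expR 1 * M) < s0 - s -> derive1 (sol s) t = pser (dcoef s) t.
  by move=> /derE[[_ <-] _]; rewrite derive1E.
split.
- apply: continuous_in_subspaceT => t; rewrite inE => /small/derE[[dt _] _].
  by apply: differentiable_continuous; exact/derivable1_diffP.
- split=> [t /oc/small/derE[[]]//|t /oc/small tM].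
  (* The derivative is [A], bounded from index [s2] to [s], applied to [sol s2]; the third index
     [s3] serves to differentiate [sol s2], which is therefore continuous at [t]. *)
  have [s2 [ss2 s2s0 ts2]] := room tM.
  have [s3 [s2s3 s3s0 ts3]] := room ts2.
  have [lin bd] := opA (lexx s) ss2 (ltW s2s0).
  set C := M / (s2 - s) in bd.
  have C0 : 0 <= C by rewrite divr_ge0 ?subr_ge0 ?ltW.
  have C1 : 0 < C + 1 by rewrite ltr_wpDl.
  have cs2 : {for t, continuous (sol s2)}.
    have [|[dt _] _] := is_derive_sol (ltW ss2) s2s3 s3s0 (t := t).
      by rewrite ratio_lt1.
    by apply: differentiable_continuous; exact/derivable1_diffP.
  have Dt (y : R) : `|y| * (expR 1 * M) < s0 - s2 ->
      emb B s (derive1 (sol s) y) = A (emb B s2 (sol s2 y)).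
    move=> ys2; have ys : `|y| * (expR 1 * M) < s0 - s.
      by apply: lt_trans ys2 _; rewrite ltrD2l ltrN2.
    rewrite derE1//; have [|_ //] := is_derive_sol (lexx s) ss2 s2s0 (t := y).
    by rewrite ratio_lt1.
  have near_t : \forall y \near t, `|y| * (expR 1 * M) < s0 - s2.
    have cM : (`|y| * (expR 1 * M)) @[y --> t] --> `|t| * (expR 1 * M).
      by apply: cvgM; [apply: cvg_norm; exact: cvg_id|exact: cvg_cst].
    exact: (cvgr_lt _ cM).
  apply/cvgrPdist_le => e e0.
  have /cvgrPdist_le/(_ _ (divr_gt0 e0 C1)) := cs2.
  move: near_t; apply: filterS2 => y ys2.
  rewrite ler_pdivlMr// mulrC => h; apply: le_trans h.
  apply: (@le_trans _ _ (C * `|sol s2 t - sol s2 y|)); last by rewrite ler_wpM2r// lerDl.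
  apply: norm_le_normr (ltW ss0) _ => //.
  rewrite linearB /= !Dt// -(linear_on_scaleB _ _ lin).
  exact: bounded_on_scale_norm_le (norm_le_emb _).
- by move=> t /small/derE[_ <-]; exists (pser (dcoef s) t).
- by move=> t /oc/small tM; rewrite derE1//; have [] := derE _ tM.
(* At time 0 every partial sum with at least one term equals the coefficient of index 0. *)
- have -> : pser (taylor_coef A u0 s) 0 = taylor_coef A u0 s 0.
    apply: lim_near_cst => //; exists 1%N => // -[//|n] _.
    rewrite /series /= big_nat_recl// expr0 scale1r big1 ?addr0// => i _.
    by rewrite expr0n scale0r.
  by rewrite emb_taylor_coef// fact0 invr1 scale1r.
Qed.

End PowerSeriesSolution.

(** * Convergence as the perturbation vanishes *)

Section Limit.
Variable R : realType.

(** Dominated convergence for series: one geometric tail is small for all [e] near the limit at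
    once, and the finitely many remaining terms tend to 0. *)
Lemma cvg_series_dominated (V : completeNormedModType R) (F : set_system R)
    (FF : ProperFilter F) (z : R -> V^nat) (C x : R) :
  0 <= x -> x < 1 -> (\forall e \near F, forall n, `|z e n| <= C * x ^+ n) ->
  (forall n, z e n @[e --> F] --> 0) ->
  `|limn (series (z e))| @[e --> F] --> 0.
Proof.
move=> x0 x1 dom z0; apply/cvgrPdist_le => d d0.
have nx : `|x| < 1 by rewrite ger0_norm.
have d2 : 0 < d / 2 by rewrite divr_gt0.
have [N _ tail] := (cvgrPdist_le _ _).1 (@cvg_geometric _ (C / (1 - x)) x nx) _ d2.
have {tail} := tail N (leqnn _); rewrite /= sub0r normrN => /(le_trans (ler_norm _)) tail.
have fin : \forall e \near F, `|series (z e) N| <= d / 2.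
  have : series (z e) N @[e --> F] --> (0 : V).
    elim: N {tail} => [|k IH].
      by rewrite /series /=; under eq_fun do rewrite big_geq//; exact: cvg_cst.
    have -> : (fun e => series (z e) k.+1) = (fun e => series (z e) k + z e k).
      by apply/funext => e; rewrite /series /= big_nat_recr.
    have := cvgD IH (z0 k); rewrite (addr0 (0 : V)) => h; exact: h.
  by move=> /cvgr0Pnorm_le; exact.
move: dom fin; apply: filterS2 => e dom fin.
have le_shift n : `|z e (n + N)%N| <= C * x ^+ N * x ^+ n.
  by rewrite -mulrA -exprD addnC dom.
have [cs le_s] := series_geometric_bound x0 x1 le_shift.
have -> : limn (series (z e)) = series (z e) N + limn (series (fun n => z e (n + N)%N)).
  apply: cvg_lim => //; rewrite -(cvg_shiftn N).
  have -> : [sequence series (z e) (n + N)%N]_n =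
      (fun n => series (z e) N + series (fun n => z e (n + N)%N) n).
    apply/funext => n; rewrite /series /= (@big_cat_nat _ _ _ N)//= ?leq_addl//.
    by congr (_ + _); rewrite -{1}(add0n N) big_addn addnK.
  by apply: cvgD => //; exact: cvg_cst.
rewrite sub0r normrN normr_id (splitr d); apply: le_trans (ler_normD _ _) _.
by apply: lerD => //; apply: le_trans le_s _; apply: le_trans tail; rewrite mulrAC.
Qed.

Variables (s0 : R) (B : banach_scale s0) (A : R -> ambient B -> ambient B).
Variables (M s : R) (u0 : R -> B s0).
Hypotheses (sgt0 : 0 < s) (M0 : 0 < M).
Hypothesis opA : forall e : R, 0 <= e -> scale_operator (A e) M s s0.

(* The loss of regularity at each iteration is harmless here, since the number
   of iterations is fixed. *)
Lemma iter_cvg (p : nat) (N : R -> R) :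
  (forall e s' s'' : R, 0 < e -> s <= s' -> s' < s'' -> s'' <= s0 ->
    bounded_on_scale (fun v => A e v - A 0 v) s'' s'
      (\sum_(1 <= k < p.+1) N e / (s'' - s') ^+ k)) ->
  (forall e : R, 0 < e -> 0 < N e) ->
  N e @[e --> 0^'+] --> 0 ->
  `|u0 e - u0 0| @[e --> 0^'+] --> 0 ->
  forall (n : nat) (s' : R), s <= s' -> s' < s0 -> forall d : R, 0 < d ->
    \forall e \near 0^'+, norm_le s'
      (iter n (A e) (emb B s0 (u0 e)) - iter n (A 0) (emb B s0 (u0 0))) d.
Proof.
move=> bdN N0 cN cu; elim=> [|n IH] s' ss' s's0 d d0.
  move/cvgr0Pnorm_le : cu => /(_ _ d0); apply: filterS => e; rewrite normr_id => ed.
  rewrite /= -linearB /=; apply: (norm_le_sub (lt_le_trans sgt0 ss') (ltW s's0) (lexx s0)).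
  by exists (u0 e - u0 0).
(* The last application takes the index from [s''] to [s']; the gap between [s0] and [s''] is left
   to the earlier ones. *)
pose s'' := (s' + s0) / 2.
have s's'' : s' < s'' by rewrite /s''; lra.
have s''s0 : s'' < s0 by rewrite /s''; lra.
have ss'' : s <= s'' by rewrite (le_trans ss')// ltW.
have C0 : 0 < M / (s'' - s') by rewrite divr_gt0// subr_gt0.
have d2 : 0 < d / 2 by rewrite divr_gt0.
have le0 := norm_le_iter sgt0 (lexx s0) (ltW M0) (opA (lexx 0)) (norm_le_emb (u0 0))
  n ss'' s''s0.
set c := (X in norm_le _ _ X) in le0.
pose K := \sum_(1 <= k < p.+1) ((s'' - s') ^+ k)^-1.
have smallN : \forall e \near 0^'+, N e * K * c <= d / 2.
  have cNK : N e * K * c @[e --> 0^'+] --> 0 * K * c.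
    by apply: cvgM; [apply: cvgM => //; exact: cvg_cst|exact: cvg_cst].
  rewrite !mul0r in cNK; move/cvgr0Pnorm_le : cNK => /(_ _ d2).
  by apply: filterS => e; apply: le_trans; exact: ler_norm.
have IHe := IH _ ss'' s''s0 _ (divr_gt0 d2 C0).
have pos : \forall e \near (0 : R)^'+, 0 < e by exact: nbhs_right_gt.
have IH0 : \forall e \near 0^'+, 0 < e /\ norm_le s''
      (iter n (A e) (emb B s0 (u0 e)) - iter n (A 0) (emb B s0 (u0 0)))
      (d / 2 / (M / (s'' - s'))).
  by move: pos IHe; apply: filterS2.
move: smallN IH0; apply: filterS2 => e Ne [e0 diff].
have [lin bd] := opA (ltW e0) ss' s's'' (ltW s''s0).
have lee := norm_le_iter sgt0 (lexx s0) (ltW M0) (opA (ltW e0)) (norm_le_emb (u0 e))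
  n ss'' s''s0.
rewrite !iterS.
set x := iter n (A e) _ in lee diff *; set y := iter n (A 0) _ in le0 diff *.
(* The perturbation acts on the unperturbed iterate [y], whose bound [c] does not depend on [e]; the
   difference [x - y] is left to the induction hypothesis. *)
have -> : A e x - A 0 y = A e (x - y) + (A e y - A 0 y).
  have [x' x'E _] := lee; have [y' y'E _] := le0.
  by rewrite -x'E -y'E -linearB (linear_on_scaleB _ _ lin) addrA addrNK.
rewrite (splitr d); apply: norm_leD.
  have -> : d / 2 = M / (s'' - s') * (d / 2 / (M / (s'' - s'))).
    by rewrite [RHS]mulrC divfK// gt_eqF.
  by apply: bounded_on_scale_norm_le diff => //; exact: ltW.
apply: norm_le_weaken Ne _.
have -> : N e * K = \sum_(1 <= k < p.+1) N e / (s'' - s') ^+ k by rewrite mulr_sumr.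
apply: (@bounded_on_scale_norm_le _ _ _ (fun v => A e v - A 0 v) s''); last exact: le0.
  2: by apply: bdN => //; exact: ltW.
rewrite sumr_ge0// => k _.
by rewrite divr_ge0 ?exprn_ge0 ?subr_ge0 ?(ltW s's'')// ltW// N0.
Qed.

(** The operator bound is uniform in [e], so one geometric series of ratio [|t| q] dominates near
    [e = 0], while [iter_cvg] gives the convergence of each coefficient. *)
Lemma pser_taylor_coef_cvg (p : nat) (N : R -> R) (t : R) :
  (forall e s' s'' : R, 0 < e -> s <= s' -> s' < s'' -> s'' <= s0 ->
    bounded_on_scale (fun v => A e v - A 0 v) s'' s'
      (\sum_(1 <= k < p.+1) N e / (s'' - s') ^+ k)) ->
  (forall e : R, 0 < e -> 0 < N e) ->
  N e @[e --> 0^'+] --> 0 ->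
  `|u0 e - u0 0| @[e --> 0^'+] --> 0 ->
  s < s0 -> `|t| * (expR 1 * M) < s0 - s ->
  `|pser (taylor_coef (A e) (u0 e) s) t - pser (taylor_coef (A 0) (u0 0) s) t|
    @[e --> 0^'+] --> 0.
Proof.
move=> bdN N0 cN cu ss0 ts.
have ds : 0 < s0 - s by rewrite subr_gt0.
set q := expR 1 * M / (s0 - s).
have q0 : 0 < q by rewrite divr_gt0// mulr_gt0// expR_gt0.
have tq : `|t| * q < 1 by rewrite mulrA ltr_pdivrMr// mul1r.
pose b e := taylor_coef (A e) (u0 e) s.
have le_b e n : 0 <= e -> `|b e n| <= `|u0 e| * q ^+ n.
  by move=> e0; exact: (norm_taylor_coef (u0 e) sgt0 M0 (opA e0) n (lexx s) ss0).
have cb e : 0 <= e -> series (fun n => t ^+ n *: b e n) @ \oo --> pser (b e) t.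
  by move=> e0; apply: (cvg_pser q0 (C := `|u0 e|)) => // n; exact: le_b.
pose z e n := t ^+ n *: (b e n - b 0 n).
have pos : \forall e \near (0 : R)^'+, 0 < e by exact: nbhs_right_gt.
have limE : \forall e \near (0 : R)^'+,
    `|limn (series (z e))| = `|pser (b e) t - pser (b 0) t|.
  move: pos; apply: filterS => e e0; congr (`|_|); apply: cvg_lim => //.
  have -> : series (z e) = (fun n => series (fun n => t ^+ n *: b e n) n -
      series (fun n => t ^+ n *: b 0 n) n).
    apply/funext => n; rewrite /series /= -sumrB; apply: eq_bigr => i _.
    by rewrite /z scalerBr.
  by apply: cvgB; apply: cb => //; exact: ltW.
suff : `|limn (series (z e))| @[e --> 0^'+] --> 0 by apply: cvg_trans; exact: near_eq_cvg.
(* Near 0 the initial values satisfy [|u0 e| <= |u0 0| + 1]; the second [|u0 0|] comes from the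
   unperturbed series. *)
apply: (@cvg_series_dominated _ _ _ _ (`|u0 0| + 1 + `|u0 0|) (`|t| * q)) => //.
- by rewrite mulr_ge0// ltW.
- have cu1 : \forall e \near (0 : R)^'+, `|u0 e - u0 0| <= 1.
    have /cvgr0Pnorm_le/(_ _ ltr01) := cu.
    by apply: filterS => e; rewrite normr_id.
  move: pos cu1; apply: filterS2 => e e0 ue n.
  rewrite normrZ normrX exprMn mulrCA ler_wpM2l ?exprn_ge0//.
  apply: le_trans (ler_normB _ _) _; rewrite mulrDl lerD ?le_b//.
  apply: le_trans (le_b _ _ (ltW e0)) _; rewrite ler_wpM2r ?exprn_ge0 ?(ltW q0)//.
  by rewrite -[u0 e](subrK (u0 0)) addrC (le_trans (ler_normD _ _))// lerD2l.
move=> n.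
suff cbn : b e n - b 0 n @[e --> 0^'+] --> 0.
  have : t ^+ n *: (b e n - b 0 n) @[e --> 0^'+] --> t ^+ n *: (0 : B s).
    by apply: cvgZ cbn; exact: cvg_cst.
  by rewrite scaler0.
apply/cvgr0Pnorm_le => d d0.
have f0 : 0 < n`!%:R :> R by rewrite ltr0n fact_gt0.
have := iter_cvg bdN N0 cN cu n (lexx s) ss0 (mulr_gt0 f0 d0).
move: pos; apply: filterS2 => e e0 diff.
apply: (norm_le_normr sgt0 (ltW ss0)); rewrite linearB /=.
rewrite (emb_taylor_coef (u0 e) sgt0 M0 (opA (ltW e0)) n (lexx s) ss0).
rewrite (emb_taylor_coef (u0 0) sgt0 M0 (opA (lexx 0)) n (lexx s) ss0).
have [y yE ley] := diff; rewrite -scalerBr -yE; exists (n`!%:R^-1 *: y).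
  by rewrite linearZ.
by rewrite normrZ ger0_norm ?invr_ge0 ?(ltW f0)// ler_pdivrMl.
Qed.

End Limit.

Theorem theorem4p3 (R : realType) :
  exists delta : R -> R,
    (forall m : R, 0 < m -> 0 < delta m) /\
    forall (s0 : R) (B : banach_scale s0)
      (A : R -> ambient B -> ambient B) (M : R -> R) (u0 : R -> B s0),
    0 < s0 ->
    {in `]0, s0[, continuous M} ->
    (forall s : R, 0 < s -> s < s0 -> 0 < M s) ->
    (forall s : R, 0 < s -> s < s0 ->
      forall e s' s'' : R, 0 <= e -> s <= s' -> s' < s'' -> s'' <= s0 ->
        linear_on_scale (A e) s'' s' /\
        bounded_on_scale (A e) s'' s' (M s / (s'' - s'))) ->
    (forall s : R, 0 < s -> s < s0 ->
      exists (p : nat) (N : R -> R),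
        [/\ forall e : R, 0 < e -> 0 < N e,
            forall e s' s'' : R, 0 < e -> s <= s' -> s' < s'' -> s'' <= s0 ->
              bounded_on_scale (fun v => A e v - A 0 v) s'' s'
                (\sum_(1 <= k < p.+1) N e / (s'' - s') ^+ k) &
            N e @[e --> 0^'+] --> (0 : R)]) ->
    `|u0 e - u0 0| @[e --> 0^'+] --> (0 : R) ->
    forall s : R, 0 < s -> s < s0 ->
      exists u : R -> R -> B s,
        (forall e : R, 0 <= e ->
          is_solution (A e) (u0 e) (delta (M s) * (s0 - s)) (u e) /\
          forall v : R -> B s,
            is_solution (A e) (u0 e) (delta (M s) * (s0 - s)) v ->
            forall t : R, t \in `[0, delta (M s) * (s0 - s)[ -> v t = u e t) /\
        forall t : R, t \in `[0, delta (M s) * (s0 - s)[ ->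
          `|u e t - u 0 t| @[e --> 0^'+] --> (0 : R).
Proof.
exists (fun m => (expR 1 * m)^-1); split=> [m m0|].
  by rewrite invr_gt0 mulr_gt0// expR_gt0.
move=> s0 B A M u0 s0_gt0 _ M0 opA appr cu s sgt0 ss0.
have opAs (r : R) : 0 < r -> r < s0 -> forall e : R, 0 <= e ->
    scale_operator (A e) (M r) r s0.
  by move=> r0 rs0 e e0 s' s''; exact: opA.
have Ms := M0 s sgt0 ss0.
exists (fun e => pser (taylor_coef (A e) (u0 e) s)); split.
  move=> e e0; have sol := is_solution_pser (u0 e) sgt0 Ms (opAs _ sgt0 ss0 _ e0) ss0.
  split=> // v solv t tT.
  (* The constant [M s] controls [A e] only down to the index [s], so uniqueness, argued below [s],
     uses [M (s / 2)]. This affects the time step there, not the length of the interval. *)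
  have r0 : 0 < s / 2 by rewrite divr_gt0.
  have rs : s / 2 < s by rewrite ltr_pdivrMr// ltr_pMr// ltr1n.
  have rs0 := lt_trans rs ss0.
  have opr : scale_operator (A e) (M (s / 2)) (s / 2) s.
    move=> s' s'' rs' s's'' s''s.
    exact: opAs r0 rs0 _ e0 _ _ rs' s's'' (le_trans s''s (ltW ss0)).
  exact: is_solution_unique r0 rs (ltW ss0) (M0 _ r0 rs0) opr sol solv _ tT.
move=> t; rewrite in_itv/= => /andP[t0 tT].
have [p [N [N0 bdN cN]]] := appr s sgt0 ss0.
apply: (pser_taylor_coef_cvg sgt0 Ms (opAs _ sgt0 ss0) bdN N0 cN cu ss0).
rewrite ger0_norm// mulrC -ltr_pdivlMl//.
by rewrite mulr_gt0// expR_gt0.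
Qed.
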